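(* Let $n\ge 3$ and let $P$ be a positive-area local optimum, with $\Delta=\delta(P)>0$. Then there exist real numbers $\lambda_t\ge 0$ ($t\in\binom{[n]}{3}$) and $\ell_i,r_i,d_i,u_i\ge 0$ ($1\le i\le n$) such that: (complementarity) $\lambda_t=0$ unless $A_t(P)=\Delta$; $\ell_i=0$ unless $x_i=0$; $r_i=0$ unless $x_i=1$; $d_i=0$ unless $y_i=0$; $u_i=0$ unless $y_i=1$; (position stationarity) $\sum_t\lambda_t\nabla_{p_i}A_t(P)+(\ell_i-r_i,\;d_i-u_i)=0$ for every $i\in[n]$; (normalization) $\sum_t\lambda_t=1$.
   Context: A configuration is $P=(p_1,\dots,p_n)$ with $p_i=(x_i,y_i)\in[0,1]^2$. For a triple $t=\{i<j<k\}$ put $D_t(P)=\det(p_j-p_i,p_k-p_i)$ and $A_t(P)=\tfrac12|D_t(P)|$, and let $\delta(P)=\min_t A_t(P)$ over all triples. A positive-area local optimum is a local maximizer $P$ of $\delta$ on $([0,1]^2)^n$ with $\delta(P)>0$. At such $P$ every $D_t(P)\ne0$; with $s_t=\operatorname{sgn}D_t(P)$, one has $A_t=\tfrac12 s_tD_t$ near $P$, and derivatives of $A_t$ at $P$ are those of this polynomial. *)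

(* Defs.v *)
From HB Require Import structures.
From mathcomp Require Import all_boot all_order all_algebra.
From mathcomp Require Import all_classical all_reals all_analysis.

Set Implicit Arguments.
Unset Strict Implicit.
Unset Printing Implicit Defensive.

Import Order.TTheory GRing.Theory Num.Theory numFieldNormedType.Exports.

Local Open Scope classical_set_scope.
Local Open Scope ring_scope.

(* A configuration of n points of the plane is P : 'M[R]_(2, n); its i-th
   column is p_i, so x_i = P 0 i and y_i = P 1 i. *)

Definition triple (n : nat) : Type :=
  {t : 'I_n * 'I_n * 'I_n | (t.1.1 < t.1.2 < t.2)%N}.
HB.instance Definition _ (n : nat) := SubFinite.on (triple n).

Definition tri1 (n : nat) (t : triple n) : 'I_n := (val t).1.1.
Definition tri2 (n : nat) (t : triple n) : 'I_n := (val t).1.2.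
Definition tri3 (n : nat) (t : triple n) : 'I_n := (val t).2.

Definition tri_det (R : realType) (n : nat) (t : triple n)
    (P : 'M[R]_(2, n)) : R :=
  \det (row_mx (col (tri2 t) P - col (tri1 t) P)
               (col (tri3 t) P - col (tri1 t) P)).

Definition area (R : realType) (n : nat) (t : triple n)
    (P : 'M[R]_(2, n)) : R :=
  2^-1 * `|tri_det t P|.

(* For n >= 3 the infimum is over a finite nonempty set, hence a minimum:
   see min_area_attained and min_area_le. *)
Definition min_area (R : realType) (n : nat) (P : 'M[R]_(2, n)) : R :=
  inf (range (fun t : triple n => area t P)).

Definition unit_square_configs (R : realType) (n : nat) : set 'M[R]_(2, n) :=
  [set P | forall c i, 0 <= P c i <= 1].

Definition local_maximizer_on (R : realType) (n : nat) (S : set 'M[R]_(2, n))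
    (f : 'M[R]_(2, n) -> R) (P : 'M[R]_(2, n)) : Prop :=
  S P /\ \forall Q \near within S (nbhs P), f Q <= f P.

Definition positive_area_local_optimum (R : realType) (n : nat)
    (P : 'M[R]_(2, n)) : Prop :=
  local_maximizer_on (@unit_square_configs R n) (@min_area R n) P
  /\ 0 < min_area P.

(* The gradient with respect to the point p_i: delta_mx c i moves the c-th
   coordinate of p_i and nothing else. *)
Definition grad_pt (R : realType) (n : nat) (i : 'I_n)
    (f : 'M[R]_(2, n) -> R) (P : 'M[R]_(2, n)) : 'cV[R]_2 :=
  \col_c 'D_(delta_mx c i) f P.

Definition vec2 (R : realType) (a b : R) : 'cV[R]_2 :=
  \col_c (if c == 0 then a else b).

Lemma min_area_le (R : realType) (n : nat) (P : 'M[R]_(2, n)) (t : triple n) :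
  min_area P <= area t P.
Proof.
apply: ge_inf; last by exists t.
by exists 0 => _ [s _ <-]; rewrite mulr_ge0 // invr_ge0.
Qed.

Lemma min_area_attained (R : realType) (n : nat) (P : 'M[R]_(2, n)) :
  (3 <= n)%N -> exists t : triple n, min_area P = area t P.
Proof.
case: n P => [|[|[|n]]] // P _.
have t0P : ((inord 0 : 'I_n.+3) < (inord 1 : 'I_n.+3) < (inord 2 : 'I_n.+3))%N.
  by rewrite !inordK.
pose t0 : triple n.+3 := Sub (inord 0, inord 1, inord 2) t0P.
case: (@arg_minP _ _ _ t0 predT (fun t => area t P)) => // t _ tmin.
exists t; apply/eqP; rewrite eq_le min_area_le /=.
by apply: lb_le_inf; [exists (area t P), t | move=> _ [s _ <-]; exact: tmin].
Qed.

Lemma tri_detE (R : realType) (n : nat) (t : triple n) (P : 'M[R]_(2, n)) :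
  tri_det t P =
    (P 0 (tri2 t) - P 0 (tri1 t)) * (P 1 (tri3 t) - P 1 (tri1 t)) -
    (P 0 (tri3 t) - P 0 (tri1 t)) * (P 1 (tri2 t) - P 1 (tri1 t)).
Proof.
have det2 (A : 'M[R]_2) : \det A = A 0 0 * A 1 1 - A 0 1 * A 1 0.
  rewrite (expand_det_row _ 0) big_ord_recl big_ord1 /cofactor !det_mx11 !mxE /=.
  rewrite expr0 mul1r expr1 mulN1r mulrN.
  by congr (_ * A _ _ - A _ _ * A _ _); apply: val_inj.
have rowl (u v : 'cV[R]_2) a : (row_mx u v : 'M[R]_2) a 0 = u a 0.
  by rewrite -(row_mxEl u v); congr (row_mx u v a _); apply: val_inj.
have rowr (u v : 'cV[R]_2) a : (row_mx u v : 'M[R]_2) a 1 = v a 0.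
  by rewrite -(row_mxEr u v); congr (row_mx u v a _); apply: val_inj.
by rewrite /tri_det det2 !rowl !rowr !mxE.
Qed.

Lemma differentiable_tri_det (R : realType) (n : nat) (t : triple n)
    (P : 'M[R]_(2, n)) :
  differentiable (@tri_det R n t) P.
Proof.
rewrite (funext (@tri_detE R n t)).
by apply: differentiableB; apply: differentiableM; apply: differentiableB;
  exact: differentiable_coord.
Qed.

Lemma area_near_smooth (R : realType) (n : nat) (t : triple n) (P : 'M[R]_(2, n)) :
  tri_det t P != 0 ->
  {near P, (fun Q => 2^-1 * (Num.sg (tri_det t P) * tri_det t Q)) =1 area t}.
Proof.
move=> DP.
have cD := differentiable_continuous (differentiable_tri_det t P).
have h : Num.sg (tri_det t P) * tri_det t Q @[Q --> P] -->
    Num.sg (tri_det t P) * tri_det t P.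
  exact: (@cvgM _ _ (nbhs P) _ (fun=> Num.sg (tri_det t P)) _ _ _ (@cvg_cst _ _ _ _ _) cD).
have : \forall Q \near P, 0 < Num.sg (tri_det t P) * tri_det t Q.
  by move: h => /cvgr_gt; apply; rewrite -normrEsg normr_gt0.
apply: filterS => Q {}h; rewrite /area; congr (_ * _).
by rewrite -(gtr0_norm h) normrM normr_sg DP mul1r.
Qed.

(* 'D_v is a total operator; at the configurations considered here, where no
   tri_det vanishes, it is a genuine derivative of the areas. *)
Lemma derivable_area (R : realType) (n : nat) (t : triple n)
    (P v : 'M[R]_(2, n)) :
  tri_det t P != 0 -> derivable (area t) P v.
Proof.
move=> /area_near_smooth /near_eq_derivable; apply; apply: diff_derivable.
apply: differentiableM; first exact: differentiable_cst.
by apply: differentiableM; [exact: differentiable_cst | exact: differentiable_tri_det].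
Qed.

(* Main.v *)
(* At a local optimum no direction keeps P in the square to first order and
   strictly increases every active area: for small h > 0 the point P + h v would
   then be in the square (the constraints are linear, so no qualification is
   needed), the active areas would exceed the minimum because of their positive
   derivatives, and the inactive ones by continuity. Motzkin's transposition
   theorem turns this infeasibility into the multipliers. *)

Require Import Defs.
From HB Require Import structures.
From mathcomp Require Import all_boot all_order all_algebra.
From mathcomp Require Import all_classical all_reals all_analysis.
From mathcomp Require Import ring lra.

Import Order.TTheory GRing.Theory Num.Theory numFieldNormedType.Exports.

Local Open Scope classical_set_scope.
Local Open Scope ring_scope.

(** Induction on the number of constraints: one index [k] is dropped, and if the vector found for
    the rest violates it, that vector serves to eliminate [a k]. The argument is purely algebraic,
    so no dimension bound on [V] and no closedness of cones enter. *)
Lemma farkas (R : realFieldType) (V : lmodType R) (I : finType) (A : {set I})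
    (a : I -> V -> R) (b : V -> R) :
  (forall i, scalar (a i)) -> scalar b ->
  (exists c : I -> R,
    [/\ forall i, 0 <= c i, forall i, i \notin A -> c i = 0
      & forall v, b v = \sum_i c i * a i v]) \/
  (exists v, (forall i, i \in A -> 0 <= a i v) /\ b v < 0).
Proof.
have [m] := ubnP #|A|; elim: m => // m IH in A a b * => Am la lb.
have [->|[k kA]] := set_0Vmem A.
  have [[v bv]|nv] := pselect (exists v, b v < 0).
    by right; exists v; split=> // i; rewrite inE.
  (* With no constraint left, [b] is nonnegative at [v] and at [- v], hence zero. *)
  left; exists (fun=> 0); split=> // v; rewrite big1 => [|i _]; last by rewrite mul0r.
  have b_ge0 w : 0 <= b w by rewrite leNgt; apply/negP => bw; apply: nv; exists w.
  apply/eqP; rewrite eq_le b_ge0 andbT.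
  have b0 : b 0 = 0 by have := lb (-1) 0 0; rewrite scaler0 addr0 mulN1r addNr.
  by have := b_ge0 (- v); have := lb (-1) v 0; rewrite addr0 b0 scaleN1r; lra.
have {}Am : (#|A :\ k| < m)%N by move: Am; rewrite (cardsD1 k) kA.
have [[c [c0 cA bE]]|[v [av bv]]] := IH _ a b Am la lb.
  by left; exists c; split=> // i iA; apply: cA; rewrite in_setD1 negb_and iA orbT.
have [akv|akv] := leP 0 (a k v).
  right; exists v; split=> // i iA; have [->//|ik] := eqVneq i k.
  by apply: av; rewrite in_setD1 ik.
(* v separates b from the other forms but violates the k-th one: recurse on the
   forms composed with the projection onto the kernel of a k along v. *)
have akv0 : a k v != 0 by rewrite lt_eqF.
pose proj (f : V -> R) w := f w - f v / a k v * a k w.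
have lin_proj f : scalar f -> scalar (proj f).
  by move=> lf x w w'; rewrite /proj lf la; ring.
have [[c [c0 cA bE]]|[w [aw bw]]] :=
  IH _ (proj \o a) (proj b) Am (fun i => lin_proj _ (la i)) (lin_proj _ lb).
  (* [ck] is the coefficient of [a k w] once the projections in [proj b = \sum_i c i * proj (a i)]
     are expanded. It is nonnegative because [b v] and [a k v] are negative while [a i v] is
     nonnegative on [A :\ k]. *)
  left; pose ck := b v / a k v - \sum_i c i * (a i v / a k v).
  exists (fun i => if i == k then ck else c i); split=> [i|i iA|w].
  - case: eqP => // _; rewrite subr_ge0; apply: (@le_trans _ _ 0).
      apply: sumr_le0 => j _; have [jA|jA] := boolP (j \in A :\ k); last first.
        by rewrite cA ?mul0r.
      by rewrite mulr_ge0_le0// mulr_ge0_le0 ?av// invr_le0 ltW.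
    by rewrite mulr_le0// ?invr_le0 ltW.
  - case: eqP => [ik|_]; first by rewrite ik kA in iA.
    by apply: cA; rewrite in_setD1 negb_and iA orbT.
  - have ck0 : c k = 0 by apply: cA; rewrite setD11.
    rewrite (bigD1 k)//= eqxx.
    rewrite (eq_bigr (fun i => c i * a i w)) => [|i /negPf ->//].
    have -> : \sum_(i | i != k) c i * a i w = \sum_i c i * a i w.
      by rewrite [RHS](bigD1 k)//= ck0 mul0r add0r.
    have -> : b w = b v / a k v * a k w + proj b w by rewrite /proj; ring.
    rewrite bE /ck mulrBl mulr_suml -addrA -sumrN; congr (_ + _).
    by rewrite -big_split; apply: eq_bigr => i _; rewrite /= /proj; ring.
(* This is [w] moved along [v] into the kernel of [a k]; any form [f] takes the value [proj f w]
   there. *)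
right; exists (- (a k w / a k v) *: v + w); split=> [i iA|].
  rewrite la; have [->|ik] := eqVneq i k; first by rewrite mulNr divfK// addNr.
  have := aw i; rewrite in_setD1 ik iA /= /proj => /(_ isT).
  by congr (_ <= _); ring.
by move: bw; rewrite lb /proj; congr (_ < _); ring.
Qed.

(** [A] and [B] will be the active areas and the active sides of the square. Multipliers indexed by
    all of [I] and [J] but vanishing off these sets express complementarity directly. *)
Lemma motzkin_transposition (R : realFieldType) (V : lmodType R) (I J : finType)
    (A : {set I}) (B : {set J}) (g : I -> V -> R) (a : J -> V -> R) :
  (forall i, scalar (g i)) -> (forall j, scalar (a j)) ->
  (exists (lam : I -> R) (mu : J -> R),
    [/\ (forall i, 0 <= lam i) /\ (forall j, 0 <= mu j),
        (forall i, i \notin A -> lam i = 0) /\ (forall j, j \notin B -> mu j = 0),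
        forall v, \sum_i lam i * g i v + \sum_j mu j * a j v = 0
      & \sum_i lam i = 1]) \/
  (exists v, (forall i, i \in A -> 0 < g i v) /\ (forall j, j \in B -> 0 <= a j v)).
Proof.
move=> lg la.
(* Farkas on V * R, with the forms (v, s) |-> g i v + s and (v, s) |-> a j v
   against the target (v, s) |-> s: a representation of the target carries the
   normalization, and a separating (v, s) has g i v >= - s > 0. *)
pose AB : {set I + J} :=
  finset (fun k : I + J => match k with inl i => i \in A | inr j => j \in B end).
pose f (k : I + J) (w : V * R^o) : R :=
  match k with inl i => g i w.1 + w.2 | inr j => a j w.1 end.
have lf k : scalar (f k).
  move=> x w w'; case: k => [i|j]; last exact: la.
  by rewrite /f lg mulrDr addrACA.
have [[c [c0 cA cE]]|[[v s] [fv /= s0]]] :=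
    farkas _ _ _ AB f _ lf (fun x w w' => erefl : (x *: w + w').2 = x * w.2 + w'.2).
  have g0 i : g i 0 = 0.
    by have := lg i (-1) 0 0; rewrite scaler0 addr0 mulN1r addNr.
  have a0 j : a j 0 = 0.
    by have := la j (-1) 0 0; rewrite scaler0 addr0 mulN1r addNr.
  left; exists (c \o inl), (c \o inr); split.
  - by split=> ?; exact: c0.
  - by split=> k kA; apply: cA; rewrite inE.
  (* Evaluation at [(v, 0)], where the target vanishes, gives stationarity; at [(0, 1)] the forms
     take the values 1 and 0, which leaves the sum of the [lam i]. *)
  - move=> v; rewrite [RHS](cE (v, 0)) big_sumType; congr (_ + _).
    by apply: eq_bigr => i _; rewrite /f /= addr0.
  - rewrite [RHS](cE (0, 1)) big_sumType /= [X in _ + X]big1 ?addr0 => [|j _].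
      by apply: eq_bigr => i _; rewrite g0 add0r mulr1.
    by rewrite a0 mulr0.
right; exists v; split=> [i iA|j jB].
  by have := fv (inl i); rewrite inE iA /f /= => /(_ isT); lra.
by have := fv (inr j); rewrite inE jB; exact.
Qed.

Lemma derive_gt0_near_right (R : realType) (V : normedModType R) (f : V -> R)
    (a v : V) :
  derivable f a v -> 0 < 'D_v f a -> \forall h \near 0^'+, f a < f (h *: v + a).
Proof.
move=> df Df; have /(_ _ Df) : forall z, z < 'D_v f a ->
    \forall h \near (0 : R)^', z < h^-1 *: (f (h *: v + a) - f a).
  exact: cvgr_gt df.
rewrite !near_withinE; apply: filterS => h fh h0.
by have := fh (lt0r_neq0 h0); rewrite /= pmulr_rgt0 ?invr_gt0// subr_gt0.
Qed.

Lemma cvg_ray (R : realType) (V : normedModType R) (a v : V) :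
  h *: v + a @[h --> (0 : R)^'+] --> a.
Proof.
rewrite -[X in _ --> X]add0r -(scale0r v).
apply: cvg_at_right_filter; apply: cvgD; last exact: cvg_cst.
by apply: cvgZ; [exact: cvg_id|exact: cvg_cst].
Qed.

(** A bound attained at [x] is preserved by the sign of [w]; a strict one survives for small [h] by
    continuity. *)
Lemma ray_in_itv (R : realType) (x w : R) :
  0 <= x <= 1 -> (x = 0 -> 0 <= w) -> (x = 1 -> w <= 0) ->
  \forall h \near 0^'+, 0 <= h * w + x <= 1.
Proof.
move=> /andP[x0 x1] w0 w1.
have cvgx : h * w + x @[h --> (0 : R)^'+] --> x := cvg_ray R R^o x w.
suff lo_hi : (\forall h \near 0^'+, 0 <= h * w + x) /\
             (\forall h \near 0^'+, h * w + x <= 1).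
  by case: lo_hi => lo hi; near=> h; apply/andP; split; near: h.
split.
- have [/esym x00|x00] := eqVneq 0 x.
    by near=> h; rewrite x00 addr0 mulr_ge0// w0.
  by near=> h; apply/ltW; near: h; apply: (cvgr_gt _ cvgx); rewrite lt_neqAle x00.
- have [x11|x11] := eqVneq x 1.
    by near=> h; rewrite x11 gerDr mulr_ge0_le0// w1.
  by near=> h; apply/ltW; near: h; apply: (cvgr_lt _ cvgx); rewrite lt_neqAle x11.
Unshelve. all: by end_near. Qed.

Lemma tri_det_neq0 (R : realType) (n : nat) (P : 'M[R]_(2, n)) (t : triple n) :
  0 < min_area P -> tri_det t P != 0.
Proof.
move=> /lt_le_trans/(_ (min_area_le P t)); apply: contraTneq => t0.
by rewrite /area t0 normr0 mulr0 ltxx.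
Qed.

Lemma continuous_area (R : realType) (n : nat) (t : triple n) :
  continuous (@area R n t).
Proof.
move=> P.
apply: (@cvgM _ _ (nbhs P) _ (fun=> 2^-1) (fun Q => `|tri_det t Q|)).
  exact: (@cvg_cst _ _ _ _ _).
by apply: cvg_norm; exact: (differentiable_continuous (differentiable_tri_det t P)).
Qed.

(** Existence of all directional derivatives would not make them linear in [v]. Linearity comes from
    the differential of the signed polynomial that agrees with [area t] near [P]. *)
Lemma derive_area_scalar (R : realType) (n : nat) (t : triple n)
    (P : 'M[R]_(2, n)) :
  tri_det t P != 0 -> scalar (fun v => 'D_v (area t) P).
Proof.
move=> /area_near_smooth areaE x u v.
have dg : differentiable (fun Q => 2^-1 * (Num.sg (tri_det t P) * tri_det t Q)) P.
  apply: differentiableM; first exact: differentiable_cst.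
  by apply: differentiableM;
    [exact: differentiable_cst | exact: differentiable_tri_det].
by rewrite -!(near_eq_derive _ areaE) !deriveE// linearP.
Qed.

Lemma no_ascent_direction (R : realType) (n : nat) (P v : 'M[R]_(2, n)) :
  (3 <= n)%N -> positive_area_local_optimum P ->
  (forall c i, P c i = 0 -> 0 <= v c i) ->
  (forall c i, P c i = 1 -> v c i <= 0) ->
  ~ (forall t : triple n, area t P = min_area P -> 0 < 'D_v (area t) P).
Proof.
move=> n3 [[sqP maxP] minP] v0 v1 ascent.
(* The middle clause is local maximality as [within] delivers it, an implication from membership in
   the square. The last clause contradicts it at a triple attaining the minimum. *)
suff [h [] ] : exists h : R, [/\ unit_square_configs (h *: v + P),
    unit_square_configs (h *: v + P) -> min_area (h *: v + P) <= min_area P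
    & forall t, min_area P < area t (h *: v + P)].
  move=> sq /(_ sq) le_min gt_min; have [t tE] := min_area_attained (h *: v + P) n3.
  by have := gt_min t; rewrite -tE ltNge le_min.
have sq_near : \forall h \near (0 : R)^'+, forall c i, 0 <= h * v c i + P c i <= 1.
  apply: filter_forall => c; apply: filter_forall => i.
  by apply: ray_in_itv; [exact: sqP|exact: v0|exact: v1].
have gt_near : \forall h \near (0 : R)^'+,
    forall t, min_area P < area t (h *: v + P).
  apply: filter_forall => t.
  have [tP|tP] := eqVneq (area t P) (min_area P).
    rewrite -tP; apply: derive_gt0_near_right; last exact: ascent.
    by apply: derivable_area; exact: tri_det_neq0.
  apply: (cvgr_gt _ (cvg_comp _ _ (cvg_ray _ _ P v) (continuous_area _ _ t P))).
  by rewrite lt_neqAle eq_sym tP min_area_le.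
apply: (@filter_ex _ (0 : R)^'+); near=> h; split.
- by move=> c i; rewrite !mxE; move: c i; near: h.
- by near: h; exact: (cvg_ray _ _ P v _ maxP).
- by near: h.
Unshelve. all: by end_near. Qed.

Theorem theorem2p3 (R : realType) (n : nat) (hn : (3 <= n)%N)
    (P : 'M[R]_(2, n)) (hP : positive_area_local_optimum P) :
  exists (lam : triple n -> R) (l r d u : 'I_n -> R),
    [/\ (forall t, 0 <= lam t) /\
        (forall i, [/\ 0 <= l i, 0 <= r i, 0 <= d i & 0 <= u i]),
        (forall t, area t P <> min_area P -> lam t = 0) /\
        (forall i, [/\ P 0 i <> 0 -> l i = 0, P 0 i <> 1 -> r i = 0,
                       P 1 i <> 0 -> d i = 0 & P 1 i <> 1 -> u i = 0]),
        forall i, (\sum_t lam t *: grad_pt i (area t) P)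
                  + vec2 (l i - r i) (d i - u i) = 0
      & \sum_t lam t = 1].
Proof.
have [_ minP] := hP.
pose A : {set triple n} := finset (fun t => area t P == min_area P).
(* [inl] indexes the sides where a coordinate is 0, [inr] those where it is 1; [a] measures the
   inward motion at each. *)
pose B : {set 'I_2 * 'I_n + 'I_2 * 'I_n} :=
  finset (fun k => match k with inl (c, i) => P c i == 0 | inr (c, i) => P c i == 1 end).
pose a (k : 'I_2 * 'I_n + 'I_2 * 'I_n) (v : 'M[R]_(2, n)) : R :=
  match k with inl (c, i) => v c i | inr (c, i) => - v c i end.
have a_scalar k : scalar (a k).
  by move=> x v w; case: k => [[c i]|[c i]]; rewrite /a !mxE// opprD mulrN.
have D_scalar t := derive_area_scalar _ _ t P (tri_det_neq0 _ _ _ t minP).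
have [[lam [mu [[lam0 mu0] [lamA muB] stat norm]]]|[v [Dv av]]] :=
  motzkin_transposition _ _ _ _ A B _ _ D_scalar a_scalar; last first.
  exfalso; apply: (no_ascent_direction _ _ P v hn hP) => [c i Pci|c i Pci|t tP].
  - by have := av (inl (c, i)); rewrite inE Pci eqxx; exact.
  - by have := av (inr (c, i)); rewrite inE Pci eqxx oppr_ge0; exact.
  - by apply: Dv; rewrite inE tP.
pose lo c i := mu (inl (c, i)); pose hi c i := mu (inr (c, i)).
have lo0 c i : P c i <> 0 -> lo c i = 0.
  by move=> Pci; apply: muB; rewrite inE; apply/eqP.
have hi0 c i : P c i <> 1 -> hi c i = 0.
  by move=> Pci; apply: muB; rewrite inE; apply/eqP.
exists lam, (lo 0), (hi 0), (lo 1), (hi 1); split=> //.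
- by split=> // i; split; exact: mu0.
- split=> [t tP|i]; last by split; [exact: lo0|exact: hi0|exact: lo0|exact: hi0].
  by apply: lamA; rewrite inE; apply/eqP.
- move=> i.
  (* Testing stationarity on [delta_mx k i] kills every side multiplier except the two attached to
     coordinate [k] of point [i]. *)
  have stat_coord k :
      \sum_t lam t * 'D_(delta_mx k i) (area t) P + (lo k i - hi k i) = 0.
    rewrite -[RHS](stat (delta_mx k i)); congr (_ + _).
    rewrite big_sumType /= -big_split (bigD1 (k, i))//= mxE !eqxx mulr1 mulrN1.
    rewrite big1 ?addr0// => -[k' i'] /negPf; rewrite xpair_eqE /= mxE => ->.
    by rewrite oppr0 !mulr0 addr0.
  apply/colP => k; rewrite !mxE summxE -[RHS](stat_coord k); congr (_ + _).
    by apply: eq_bigr => t _; rewrite !mxE.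
  have [->//|k0] := eqVneq k 0.
  by have -> : k = 1 by apply: val_inj; case: k k0 => [[|[]]].
Qed.
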